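(* Let $\phi:\mathbb{D}\to\mathbb{D}$ and $\psi:\mathbb{D}\to\mathbb{C}$ be analytic such that $C_{\psi,\phi}$ is a bounded operator on $\mathcal{D}$, where $\phi(0)=0$ and $\psi$ has a zero of multiplicity $r>0$ at the origin. If $\hat\psi_r$ denotes the coefficient of $z^r$ in the Taylor expansion of $\psi$ at $0$, then $W(C_{\psi,\phi})$ contains the disk centered at the origin with radius $\frac{r+1}{r+2}|\hat\psi_r|$.
   Context: $\mathbb{D}=\{z\in\mathbb{C}:|z|<1\}$. The Dirichlet space $\mathcal{D}$ is the Hilbert space of all holomorphic $f(z)=\sum_{n\ge0}\hat f_nz^n$ on $\mathbb{D}$ with $\sum_{n\ge 0}(n+1)|\hat f_n|^2<\infty$ (equivalently $\int_{\mathbb{D}}|f'|^2dA<\infty$), with inner product $\langle f,g\rangle_{\mathcal{D}}=\sum_{n\ge0}(n+1)\hat f_n\overline{\hat g_n}$. The weighted composition operator is $(C_{\psi,\phi}f)(z)=\psi(z)f(\phi(z))$. The numerical range of a bounded operator $T$ on a Hilbert space $\mathcal{H}$ is $W(T)=\{\langle Tf,f\rangle:f\in\mathcal{H},\|f\|=1\}$. *)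

(* Defs.v *)
From Stdlib Require Export Reals Factorial.
From Coquelicot Require Export Coquelicot.
Open Scope C_scope.

(* Functions on the unit disk are represented by total functions C -> C, all
   notions below depending only on their values at points with Cmod z < 1. *)

Definition holomorphic_on_disk (f : C -> C) : Prop :=
  forall z : C, Cmod z < 1 -> @ex_derive C_AbsRing C_NormedModule f z.

(* f^(n)(0) / n!, with C_derive the complex derivative *)
Definition taylor_coef (f : C -> C) (n : nat) : C :=
  Nat.iter n C_derive f (RtoC 0) / RtoC (INR (fact n)).

(* For a holomorphic f the second clause is automatic (Taylor's theorem); it is
   spelled out as part of f(z) = sum_n f_n z^n. *)
Definition dirichlet_space (f : C -> C) : Prop :=
  holomorphic_on_disk f /\
  (forall z : C, Cmod z < 1 ->
     @is_pseries C_AbsRing C_NormedModule (taylor_coef f) z (f z)) /\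
  ex_series (fun n : nat => (INR n + 1) * Cmod (taylor_coef f n) ^ 2)%R.

(* Sum of a convergent complex series, computed componentwise. *)
Definition CSeries (a : nat -> C) : C :=
  (Series (fun n => Re (a n)), Series (fun n => Im (a n))).

Definition dirichlet_inner (f g : C -> C) : C :=
  CSeries (fun n : nat =>
    RtoC (INR n + 1) * taylor_coef f n * Cconj (taylor_coef g n)).

Definition dirichlet_norm (f : C -> C) : R := sqrt (Re (dirichlet_inner f f)).

Definition dirichlet_bounded (T : (C -> C) -> C -> C) : Prop :=
  (forall f, dirichlet_space f -> dirichlet_space (T f)) /\
  exists M : R, forall f, dirichlet_space f ->
    (dirichlet_norm (T f) <= M * dirichlet_norm f)%R.

Definition numerical_range (T : (C -> C) -> C -> C) (w : C) : Prop :=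
  exists f : C -> C,
    dirichlet_space f /\ dirichlet_norm f = 1 /\ w = dirichlet_inner (T f) f.

Definition weighted_composition (psi phi f : C -> C) : C -> C :=
  fun z => psi z * f (phi z).

Definition zero_of_multiplicity_at_origin (psi : C -> C) (r : nat) : Prop :=
  exists g : C -> C,
    holomorphic_on_disk g /\ g (RtoC 0) <> RtoC 0 /\
    forall z : C, Cmod z < 1 -> psi z = z ^ r * g z.

(* Main.v *)
Require Import Defs.
From Stdlib Require Import Lra Lia FunctionalExtensionality.
Open Scope C_scope.

(** The unit vectors of the plane spanned by 1 and z^r already produce every
    point of the disk.  Write T for the weighted composition operator and take
    f = a + b z^r, so that T f = a psi + b psi phi^r.  Since phi(0) = 0 and psi
    vanishes to order r, the function psi phi^r is o(z^r) at the origin and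
    contributes nothing to the Taylor coefficients of T f up to index r.  The
    coefficient of index 0 of T f is a psi(0) = 0 and the one of index r is
    a psi_r.  Because f has only two nonzero coefficients, the series for the
    inner product reduces to

      <T f, f> = (r+1) a psi_r conj(b),    ||f||^2 = |a|^2 + (r+1) |b|^2.

    On the unit sphere |a||b| takes every value from 0 to 1/(2 sqrt(r+1)), and
    the phases of a and b are free, so these values fill the disk of radius
    sqrt(r+1)/2 |psi_r|; the radius (r+1)/(r+2) |psi_r| is at most this one by
    the inequality 2 sqrt(r+1) <= r+2 between arithmetic and geometric means.

    Two facts carry the argument.  The Taylor coefficients are defined by
    iterated derivatives, and apart from psi(0) the only ones computed from that
    definition are those of polynomials ([taylor_coef_polynomial]).  For T f, which is known
    only to be the sum of its Taylor series, the coefficients are found by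
    uniqueness: a power series whose sum is o(z^r) has zero coefficients up to
    index r ([cpseries_low_coefs_vanish], applied to T f - a psi in
    [weighted_composition_taylor_coef]).  The choice of a and b is
    [two_dim_compression_range]. *)

(** * Complex power series with small sum near the origin *)

Notation is_cpseries := (@is_pseries C_AbsRing C_NormedModule).

Lemma pow_n_Cpow (z : C) (n : nat) : @pow_n C_AbsRing z n = z ^ n.
Proof.
induction n as [|n IHn]; [reflexivity|].
change (z * @pow_n C_AbsRing z n = z * z ^ n). now rewrite IHn.
Qed.

Lemma norm_C (x : C) : @norm C_AbsRing C_NormedModule x = Cmod x.
Proof. reflexivity. Qed.

(** Each term is a difference of two partial sums, and these converge. *)
Lemma cpseries_term_bound (a : nat -> C) (z l : C) :
  is_cpseries a z l -> exists M : R, forall n, (Cmod (z ^ n * a n) <= M)%R.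
Proof.
intros Ha.
destruct (@filterlim_bounded C_AbsRing C_NormedModule _ (ex_intro _ l Ha)) as [M HM].
exists (2 * M)%R; intros n.
assert (HM' : forall n, (Cmod (@sum_n C_NormedModule (fun k => (z ^ k * a k)%C) n) <= M)%R).
{ intros k. generalize (HM k). rewrite norm_C.
  rewrite (sum_n_ext _ (fun k => z ^ k * a k)); [easy|].
  intros j. now rewrite pow_n_Cpow. }
destruct n as [|n].
- generalize (HM' 0%nat). rewrite sum_O.
  generalize (Cmod_ge_0 (z ^ 0 * a 0%nat)). lra.
- generalize (HM' n) (HM' (S n)). rewrite sum_Sn.
  set (s := sum_n _ n). set (t := z ^ S n * a (S n)).
  change (plus s t) with (s + t). intros H1 H2.
  replace t with ((s + t) + - s) by ring.
  eapply Rle_trans; [apply Cmod_triangle|]. rewrite Cmod_opp. lra.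
Qed.

Definition vanishes_at_origin (h : C -> C) : Prop :=
  forall eps : R, (0 < eps)%R ->
    exists del : R, (0 < del)%R /\ forall z, (Cmod z < del)%R -> (Cmod (h z) < eps)%R.

(** The hypothesis says |a_n| <= M 2^n, so for |z| <= 1/4 the terms of positive
    index are dominated by a geometric series of ratio 2|z| <= 1/2.  The factor
    1 - 2^-N lets the bound go through by induction on N. *)
Lemma cpseries_partial_sum_bound (a : nat -> C) (M : R) (z : C) (N : nat) :
  (forall n, Cmod (RtoC (/2) ^ n * a n) <= M)%R -> (Cmod z <= /4)%R ->
  (Cmod (@sum_n C_NormedModule (fun k => (z ^ k * a k)%C) N - a 0%nat)
     <= 4 * M * Cmod z * (1 - (/2) ^ N))%R.
Proof.
intros HM Hz.
assert (Hc := Cmod_ge_0 z).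
assert (M0 : (0 <= M)%R) by (eapply Rle_trans; [apply Cmod_ge_0|apply (HM 0%nat)]).
induction N as [|N IHN].
- rewrite sum_O. replace (z ^ 0 * a 0%nat - a 0%nat) with (RtoC 0) by (simpl; ring).
  rewrite Cmod_0. simpl. lra.
- rewrite sum_Sn. set (s := sum_n _ N) in *. set (t := z ^ S N * a (S N)).
  change (plus s t) with (s + t).
  replace (s + t - a 0%nat) with ((s - a 0%nat) + t) by ring.
  eapply Rle_trans; [apply Cmod_triangle|].
  assert (Ht : (Cmod t <= 4 * M * Cmod z * (/2) ^ S N)%R).
  { assert (E : t = (2 * z) ^ S N * (RtoC (/2) ^ S N * a (S N))).
    { unfold t. rewrite Cpow_mult_l.
      assert (E : 2 ^ S N * RtoC (/2) ^ S N = 1).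
      { rewrite <- Cpow_mult_l, <- RtoC_mult, Rinv_r, Cpow_1_l; [easy|lra]. }
      transitivity (z ^ S N * a (S N) * (2 ^ S N * RtoC (/2) ^ S N)); [|ring].
      rewrite E; ring. }
    rewrite E, Cmod_mult, Cmod_pow, Cmod_mult, Cmod_R, Rabs_pos_eq by lra.
    assert (H1 : ((2 * Cmod z) ^ N <= (/2) ^ N)%R) by (apply pow_incr; lra).
    assert (H2 : (0 <= (2 * Cmod z) ^ N)%R) by (apply pow_le; lra).
    simpl pow.
    apply Rle_trans with (2 * Cmod z * (2 * Cmod z) ^ N * M)%R.
    - apply Rmult_le_compat_l; [nra|apply (HM (S N))].
    - replace (4 * M * Cmod z * (/ 2 * (/ 2) ^ N))%R
        with (2 * Cmod z * (/ 2) ^ N * M)%R by field.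
      apply Rmult_le_compat_r; [easy|]. apply Rmult_le_compat_l; [lra|easy]. }
  simpl pow in *. nra.
Qed.

(** The sum of a power series is continuous at 0: partial sums at x are at
    distance O(x) from a_0, uniformly in their length, while the sum h(x) tends
    to 0.  The point 0 is excluded from the hypothesis so that the lemma applies
    to a sum divided by z. *)
Lemma cpseries_vanishing_coef0 (a : nat -> C) (h : C -> C) :
  (forall z : C, z <> 0 -> Cmod z < 1 -> is_cpseries a z (h z)) ->
  vanishes_at_origin h -> a 0%nat = 0.
Proof.
intros Ha Hh.
destruct (Ceq_dec (a 0%nat) 0) as [E|E]; [exact E|exfalso].
apply Cmod_gt_0 in E. set (e := Cmod (a 0%nat)) in *.
destruct (cpseries_term_bound a (RtoC (/2)) (h (RtoC (/2)))) as [M HM].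
{ apply Ha.
  - intros H; apply RtoC_inj in H; lra.
  - rewrite Cmod_R, Rabs_pos_eq; lra. }
destruct (Hh (e / 3)%R) as [d [Hd Hd']]; [lra|].
assert (M0 : (0 <= M)%R) by (eapply Rle_trans; [apply Cmod_ge_0|apply (HM 0%nat)]).
(* x is within the radius where |h| < e/3, within the disk |z| <= 1/4, and so
   small that 4 M x <= e/3; with a partial sum e/3-close to h(x), the three
   errors add up to less than e = |a_0|. *)
set (x := Rmin (d / 2) (Rmin (/4) (e / (12 * (M + 1))))).
assert (Hq : (0 < e / (12 * (M + 1)))%R) by (apply Rdiv_lt_0_compat; lra).
assert (X0 : (0 < x)%R) by (unfold x; repeat apply Rmin_pos; lra).
assert (X1 : (x <= d / 2)%R) by apply Rmin_l.
assert (X2 : (x <= /4)%R) by (eapply Rle_trans; [apply Rmin_r|apply Rmin_l]).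
assert (X3 : (x <= e / (12 * (M + 1)))%R) by (eapply Rle_trans; [apply Rmin_r|apply Rmin_r]).
assert (Cx : Cmod (RtoC x) = x) by (rewrite Cmod_R, Rabs_pos_eq; lra).
assert (Hs := Ha (RtoC x)).
assert (Hx : is_cpseries a (RtoC x) (h (RtoC x))).
{ apply Hs; [intros H; apply RtoC_inj in H; lra| rewrite Cx; lra]. }
unfold is_pseries, is_series in Hx.
assert (e3 : (0 < e / 3)%R) by lra.
destruct (proj1 (filterlim_locally_ball_norm _ _) Hx (mkposreal _ e3)) as [N HN].
specialize (HN N (le_n N)). unfold ball_norm in HN. rewrite norm_C in HN. simpl in HN.
rewrite (sum_n_ext _ (fun k => RtoC x ^ k * a k)) in HN
  by (intros j; now rewrite pow_n_Cpow).
set (s := sum_n _ N) in HN.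
assert (HB := cpseries_partial_sum_bound a M (RtoC x) N HM).
rewrite Cx in HB.
change (x <= /4 -> Cmod (s - a 0%nat) <= 4 * M * x * (1 - (/2) ^ N))%R in HB.
specialize (HB X2).
specialize (Hd' (RtoC x)). rewrite Cx in Hd'.
assert (H1 : (Cmod (h (RtoC x)) < e / 3)%R) by (apply Hd'; lra).
change (Cmod (s - h (RtoC x)) < e / 3)%R in HN.
assert (HT : (e <= Cmod (h (RtoC x)) + Cmod (s - h (RtoC x)) + Cmod (s - a 0%nat))%R).
{ unfold e. replace (a 0%nat) with ((h (RtoC x) + (s - h (RtoC x))) + - (s - a 0%nat)) at 1 by ring.
  eapply Rle_trans; [apply Cmod_triangle|]. rewrite Cmod_opp.
  apply Rplus_le_compat_r, Cmod_triangle. }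
assert (HP : (0 <= (/2) ^ N)%R) by (apply pow_le; lra).
assert (H4 : (4 * M * x * (1 - (/2) ^ N) <= 4 * M * x)%R).
{ assert (0 <= 4 * M * x)%R by nra. nra. }
assert (H5 : (4 * M * x <= e / 3)%R).
{ apply Rle_trans with (4 * (M + 1) * (e / (12 * (M + 1))))%R.
  - nra.
  - right; field; lra. }
lra.
Qed.

(** Continuity at 0 kills the constant coefficient; dividing the series by z
    then lowers r by one. *)
Lemma cpseries_low_coefs_vanish (r : nat) : forall (a : nat -> C) (h : C -> C),
  (forall z : C, z <> 0 -> Cmod z < 1 -> is_cpseries a z (z ^ r * h z)) ->
  vanishes_at_origin h -> forall k, (k <= r)%nat -> a k = 0.
Proof.
induction r as [|r IHr]; intros a h Ha Hh k Hk.
- replace k with 0%nat by lia.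
  apply (cpseries_vanishing_coef0 a h); [|exact Hh].
  intros z Z0 Z1. replace (h z) with (z ^ 0 * h z) by (simpl; ring). auto.
- assert (A0 : a 0%nat = 0).
  { apply (cpseries_vanishing_coef0 a (fun z => z ^ S r * h z)); [auto|].
    intros eps He. destruct (Hh eps He) as [d [D0 D1]].
    exists (Rmin 1 d). split; [apply Rmin_pos; lra|].
    intros z Hz.
    assert (Z1 : (Cmod z < 1)%R) by (eapply Rlt_le_trans; [exact Hz|apply Rmin_l]).
    assert (Z2 : (Cmod z < d)%R) by (eapply Rlt_le_trans; [exact Hz|apply Rmin_r]).
    rewrite Cmod_mult, Cmod_pow.
    assert (H1 : (Cmod z ^ S r <= 1 ^ S r)%R)
      by (apply pow_incr; generalize (Cmod_ge_0 z); lra).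
    rewrite pow1 in H1.
    generalize (D1 z Z2) (Cmod_ge_0 (h z)). intros.
    nra. }
  destruct k as [|k]; [exact A0|].
  apply (IHr (@PS_decr_1 C_AbsRing C_NormedModule a) h); [|exact Hh|lia].
  intros z Z0 Z1.
  replace (z ^ r * h z) with (/ z * (z ^ S r * h z + - a 0%nat)).
  + apply (@is_pseries_decr_1 C_AbsRing C_NormedModule); [|auto].
    now apply Cinv_l.
  + rewrite A0. simpl. field. exact Z0.
Qed.

Lemma differentiable_at_origin_continuous (f : C -> C) :
  @ex_derive C_AbsRing C_NormedModule f (RtoC 0) ->
  vanishes_at_origin (fun z => f z - f (RtoC 0)).
Proof.
intros Hf eps He.
apply ex_derive_continuous in Hf.
assert (HN := locally_ball_norm (V := C_NormedModule) (f (RtoC 0)) (mkposreal eps He)).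
destruct (Hf _ HN) as [d Hd].
exists d; split; [apply cond_pos|]. intros z Hz.
specialize (Hd z). unfold ball_norm in Hd. rewrite norm_C in Hd.
apply Hd. change (Cmod (z - 0) < d)%R. now replace (z - 0) with z by ring.
Qed.

(** * Taylor coefficients of polynomials *)

(** The monomials have the shape of the terms of [is_pseries], so that a
    polynomial is literally a partial sum of the power series of its
    coefficients. *)
Definition polynomial (p : nat -> C) (N : nat) (z : C) : C :=
  @sum_n C_NormedModule (fun k => @scal C_AbsRing C_NormedModule (@pow_n C_AbsRing z k) (p k)) N.

(** The product rule holds for functions into the ring C, whose topology is the
    one of the modulus; it is transferred to the normed module C, which has the
    product topology, by multiplying by the fixed vector c. *)
Lemma is_derive_monomial (c : C) (n : nat) (z : C) :
  @is_derive C_AbsRing C_NormedModule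
    (fun z => @scal C_AbsRing C_NormedModule (@pow_n C_AbsRing z n) c) z
    (z ^ pred n * (RtoC (INR n) * c)).
Proof.
assert (H : @is_derive C_AbsRing (AbsRing_NormedModule C_AbsRing)
   (fun z => @pow_n C_AbsRing z n) z (z ^ pred n * RtoC (INR n))).
{ induction n as [|n IHn].
  - simpl. replace (1 * RtoC 0) with (@zero C_AbsRing) by (change (RtoC 0 = 1 * RtoC 0); ring).
    apply (@is_derive_const C_AbsRing (AbsRing_NormedModule C_AbsRing)).
  - assert (H := is_derive_mult (K := C_AbsRing) _ _ z _ _ (is_derive_id z) IHn Cmult_comm).
    eapply is_derive_ext; [|eapply eq_ind; [exact H|]].
    + intros t; reflexivity.
    + rewrite pow_n_Cpow.
      change (1 * z ^ n + z * (z ^ pred n * RtoC (INR n)) = z ^ n * RtoC (INR (S n))).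
      rewrite S_INR, RtoC_plus. destruct n as [|n]; simpl pred; [simpl; ring|].
      rewrite Cpow_S. ring. }
assert (H' := is_derive_scal_l (K := C_AbsRing) (V := C_NormedModule) _ z _ c H).
eapply eq_ind; [exact H'|].
change (z ^ pred n * RtoC (INR n) * c = z ^ pred n * (RtoC (INR n) * c)). ring.
Qed.

Lemma sum_n_vanishing_head {G : AbelianMonoid} (u : nat -> G) (N : nat) :
  u 0%nat = zero -> sum_n u (S N) = sum_n (fun k => u (S k)) N.
Proof.
intros H. induction N as [|N IHN].
- now rewrite sum_Sn, !sum_O, H, plus_zero_l.
- now rewrite sum_Sn, IHN, sum_Sn.
Qed.

(** The degree bound N is kept although the degree drops, so that the lemma can be
    iterated. *)
Lemma is_derive_polynomial (p : nat -> C) (N : nat) (z : C) :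
  (forall k, (N < k)%nat -> p k = 0) ->
  @is_derive C_AbsRing C_NormedModule (polynomial p N) z
    (polynomial (fun k => RtoC (INR (S k)) * p (S k)) N z).
Proof.
intros Hp.
assert (H := is_derive_sum_n (K := C_AbsRing) (V := C_NormedModule)
  (fun k z => @scal C_AbsRing C_NormedModule (@pow_n C_AbsRing z k) (p k)) N z _
  (fun k _ => is_derive_monomial (p k) k z)).
eapply eq_ind; [exact H|].
transitivity (@sum_n C_NormedModule (fun k : nat => z ^ pred k * (RtoC (INR k) * p k)) (S N)).
- rewrite sum_Sn, (Hp (S N)) by lia.
  replace (z ^ pred (S N) * (RtoC (INR (S N)) * 0)) with (@zero C_NormedModule)
   by (change (RtoC 0 = z ^ pred (S N) * (RtoC (INR (S N)) * 0)); ring).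
  now rewrite plus_zero_r.
- rewrite sum_n_vanishing_head.
  + apply sum_n_ext; intros k.
    change (z ^ k * (RtoC (INR (S k)) * p (S k)) =
            @pow_n C_AbsRing z k * (RtoC (INR (S k)) * p (S k))).
    now rewrite (pow_n_Cpow z k).
  + change (z ^ pred 0 * (0 * p 0%nat) = 0). ring.
Qed.

Lemma iter_C_derive_polynomial (n : nat) : forall (p : nat -> C) (N : nat),
  (forall k, (N < k)%nat -> p k = 0) ->
  Nat.iter n C_derive (polynomial p N) (RtoC 0) = RtoC (INR (fact n)) * p n.
Proof.
induction n as [|n IHn]; intros p N Hp.
- change (polynomial p N (RtoC 0) = RtoC 1 * p 0%nat).
  unfold polynomial. clear Hp. induction N as [|N IHN].
  + rewrite sum_O. reflexivity.
  + rewrite sum_Sn, IHN, pow_n_Cpow.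
    change (1 * p 0%nat + 0 * 0 ^ N * p (S N) = 1 * p 0%nat). ring.
- rewrite Nat.iter_succ_r.
  replace (C_derive (polynomial p N))
    with (polynomial (fun k => RtoC (INR (S k)) * p (S k)) N).
  + rewrite IHn.
    * rewrite fact_simpl, mult_INR, RtoC_mult. ring.
    * intros k Hk. rewrite Hp by lia. ring.
  + apply functional_extensionality; intros z. symmetry.
    apply is_C_derive_unique, is_derive_polynomial, Hp.
Qed.

Lemma taylor_coef_polynomial (p : nat -> C) (N : nat) :
  (forall k, (N < k)%nat -> p k = 0) -> taylor_coef (polynomial p N) = p.
Proof.
intros Hp. apply functional_extensionality; intros n. unfold taylor_coef.
rewrite iter_C_derive_polynomial by exact Hp. field.
intros H. apply RtoC_inj in H. exact (INR_fact_neq_0 n H).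
Qed.

(** * The Dirichlet inner product against a + b z^r *)

Lemma is_series_finite_support {K : AbsRing} {V : NormedModule K} (u : nat -> V) (N : nat) :
  (forall k, (N < k)%nat -> u k = zero) -> is_series u (sum_n u N).
Proof.
intros Hu. apply filterlim_ext_loc with (fun _ => sum_n u N).
- exists N. intros n Hn. induction Hn as [|n Hn IHn]; [reflexivity|].
  rewrite sum_Sn, <- IHn, Hu by lia. now rewrite plus_zero_r.
- apply filterlim_const.
Qed.

Lemma dirichlet_space_polynomial (p : nat -> C) (N : nat) :
  (forall k, (N < k)%nat -> p k = 0) -> dirichlet_space (polynomial p N).
Proof.
intros Hp. repeat split.
- intros z _. eexists. now apply is_derive_polynomial.
- intros z _. rewrite taylor_coef_polynomial by exact Hp.
  apply is_series_finite_support. intros k Hk. rewrite Hp by exact Hk.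
  apply (@scal_zero_r C_AbsRing C_NormedModule).
- rewrite taylor_coef_polynomial by exact Hp. eexists.
  apply (is_series_finite_support (K := R_AbsRing) (V := R_NormedModule)
    (fun n => ((INR n + 1) * Cmod (p n) ^ 2)%R) N).
  intros k Hk. rewrite Hp, Cmod_0 by exact Hk. change ((INR k + 1) * 0 ^ 2 = 0)%R. ring.
Qed.

Lemma sum_n_two_terms {G : AbelianMonoid} (u : nat -> G) (r : nat) :
  (0 < r)%nat -> (forall k, k <> 0%nat -> k <> r -> u k = zero) ->
  sum_n u r = plus (u 0%nat) (u r).
Proof.
intros Hr Hu. destruct r as [|r]; [lia|]. rewrite sum_Sn. f_equal.
assert (H : forall m, (m <= r)%nat -> sum_n u m = u 0%nat).
{ induction m as [|m IHm]; intros Hm; [apply sum_O|].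
  rewrite sum_Sn, IHm, (Hu (S m)) by lia. apply plus_zero_r. }
now apply H.
Qed.

Lemma CSeries_two_terms (u : nat -> C) (r : nat) :
  (0 < r)%nat -> (forall k, k <> 0%nat -> k <> r -> u k = 0) ->
  CSeries u = u 0%nat + u r.
Proof.
intros Hr Hu.
assert (H : forall v : nat -> R, (forall k, k <> 0%nat -> k <> r -> v k = 0%R) ->
  Series v = (v 0%nat + v r)%R).
{ intros v Hv. apply is_series_unique.
  change (v 0%nat + v r)%R with (@plus R_AbelianMonoid (v 0%nat) (v r)).
  rewrite <- (sum_n_two_terms (G := R_AbelianMonoid)) by assumption.
  apply (is_series_finite_support (K := R_AbsRing) (V := R_NormedModule)).
  intros k Hk. apply Hv; lia. }
unfold CSeries. rewrite !H; [reflexivity| |]; intros k K0 K1; now rewrite Hu.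
Qed.

Definition two_term_coefs (r : nat) (a b : C) (k : nat) : C :=
  if Nat.eqb k 0 then a else if Nat.eqb k r then b else 0.

Lemma two_term_coefs_0 r a b : two_term_coefs r a b 0 = a.
Proof. reflexivity. Qed.

Lemma two_term_coefs_r r a b : (0 < r)%nat -> two_term_coefs r a b r = b.
Proof. intros Hr. unfold two_term_coefs. rewrite Nat.eqb_refl. now destruct r; [lia|]. Qed.

Lemma two_term_coefs_other r a b k :
  k <> 0%nat -> k <> r -> two_term_coefs r a b k = 0.
Proof.
intros K0 K1. unfold two_term_coefs.
now rewrite (proj2 (Nat.eqb_neq _ _) K0), (proj2 (Nat.eqb_neq _ _) K1).
Qed.

Lemma polynomial_two_terms r a b z :
  (0 < r)%nat -> polynomial (two_term_coefs r a b) r z = a + b * z ^ r.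
Proof.
intros Hr. unfold polynomial. rewrite sum_n_two_terms; [|exact Hr|].
- rewrite two_term_coefs_0, two_term_coefs_r, pow_n_Cpow by exact Hr.
  change (1 * a + z ^ r * b = a + b * z ^ r). ring.
- intros k K0 K1. rewrite two_term_coefs_other by assumption.
  apply (@scal_zero_r C_AbsRing C_NormedModule).
Qed.

Lemma dirichlet_inner_two_terms (f : C -> C) r a b :
  (0 < r)%nat ->
  dirichlet_inner f (polynomial (two_term_coefs r a b) r) =
  taylor_coef f 0 * Cconj a + RtoC (INR r + 1) * taylor_coef f r * Cconj b.
Proof.
intros Hr. unfold dirichlet_inner.
rewrite taylor_coef_polynomial.
2: { intros k Hk. apply two_term_coefs_other; lia. }
rewrite CSeries_two_terms with (r := r); [|exact Hr|].
- rewrite two_term_coefs_0, two_term_coefs_r by exact Hr.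
  simpl INR. rewrite Rplus_0_l. ring.
- intros k K0 K1. rewrite two_term_coefs_other by assumption.
  replace (Cconj 0) with (RtoC 0); [ring|].
  unfold Cconj, RtoC; simpl; f_equal; ring.
Qed.

Lemma dirichlet_norm_two_terms r a b :
  (0 < r)%nat ->
  dirichlet_norm (polynomial (two_term_coefs r a b) r) =
  sqrt (Cmod a ^ 2 + (INR r + 1) * Cmod b ^ 2).
Proof.
intros Hr. unfold dirichlet_norm. rewrite dirichlet_inner_two_terms by exact Hr.
rewrite taylor_coef_polynomial.
2: { intros k Hk. apply two_term_coefs_other; lia. }
rewrite two_term_coefs_0, two_term_coefs_r by exact Hr.
rewrite <- Cmult_assoc, <- !Cmod2_conj, <- RtoC_mult, <- RtoC_plus. reflexivity.
Qed.

(** * The operator on the plane spanned by 1 and z^r *)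

(** Near the origin b g is bounded and |phi^r| <= |phi|, which tends to 0. *)
Lemma product_vanishes_at_origin (g phi : C -> C) (b : C) (r : nat) :
  holomorphic_on_disk g -> holomorphic_on_disk phi -> phi 0 = 0 -> (0 < r)%nat ->
  vanishes_at_origin (fun z => b * g z * phi z ^ r).
Proof.
intros Hg Hphi Hphi0 Hr eps He.
assert (Z1 : (Cmod 0 < 1)%R) by (rewrite Cmod_0; lra).
destruct (differentiable_at_origin_continuous g (Hg 0 Z1) 1%R Rlt_0_1) as [d1 [D1 H1]].
set (K := (Cmod b * (Cmod (g 0) + 1))%R).
assert (K0 : (0 <= K)%R).
{ apply Rmult_le_pos; [apply Cmod_ge_0|generalize (Cmod_ge_0 (g 0)); lra]. }
assert (E0 : (0 < Rmin 1 (eps / (K + 1)))%R).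
{ apply Rmin_pos; [lra|apply Rdiv_lt_0_compat; lra]. }
destruct (differentiable_at_origin_continuous phi (Hphi 0 Z1) _ E0) as [d2 [D2 H2]].
exists (Rmin d1 d2). split; [now apply Rmin_pos|]. intros z Hz.
specialize (H1 z (Rlt_le_trans _ _ _ Hz (Rmin_l _ _))).
specialize (H2 z (Rlt_le_trans _ _ _ Hz (Rmin_r _ _))).
simpl in H1, H2. rewrite Hphi0 in H2. replace (phi z - 0) with (phi z) in H2 by ring.
assert (P1 := Rlt_le_trans _ _ _ H2 (Rmin_l _ _)).
assert (P2 := Rlt_le_trans _ _ _ H2 (Rmin_r _ _)).
assert (P0 := Cmod_ge_0 (phi z)).
rewrite !Cmod_mult, Cmod_pow.
assert (G1 : (Cmod (g z) <= Cmod (g 0) + 1)%R).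
{ replace (g z) with (g 0 + (g z - g 0)) by ring.
  eapply Rle_trans; [apply Cmod_triangle|lra]. }
assert (GK : (Cmod b * Cmod (g z) <= K)%R)
  by (apply Rmult_le_compat_l; [apply Cmod_ge_0|exact G1]).
assert (PR : (Cmod (phi z) ^ r <= Cmod (phi z))%R).
{ destruct r as [|r]; [lia|]. simpl.
  assert (Cmod (phi z) ^ r <= 1 ^ r)%R by (apply pow_incr; lra).
  rewrite pow1 in *. nra. }
apply Rle_lt_trans with (K * Cmod (phi z))%R.
- apply Rmult_le_compat; [|now apply pow_le|exact GK|exact PR].
  apply Rmult_le_pos; apply Cmod_ge_0.
- apply Rle_lt_trans with (K * (eps / (K + 1)))%R; [apply Rmult_le_compat_l; lra|].
  apply Rmult_lt_reg_r with (K + 1)%R; [lra|].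
  replace (K * (eps / (K + 1)) * (K + 1))%R with (K * eps)%R by (field; lra). nra.
Qed.

(** Both T f and psi = T 1 lie in the Dirichlet space, hence are the sums of their
    Taylor series; their combination T f - a psi = b psi phi^r is z^r times a
    function tending to 0, so its coefficients vanish up to index r. *)
Lemma weighted_composition_taylor_coef (phi psi g : C -> C) (r : nat) (a b : C) :
  let T := weighted_composition psi phi in
  (forall f, dirichlet_space f -> dirichlet_space (T f)) ->
  holomorphic_on_disk phi -> phi 0 = 0 -> (0 < r)%nat ->
  holomorphic_on_disk g -> (forall z, Cmod z < 1 -> psi z = z ^ r * g z) ->
  forall k, (k <= r)%nat ->
    taylor_coef (T (polynomial (two_term_coefs r a b) r)) k = a * taylor_coef psi k.
Proof.
intros T HT Hphi Hphi0 Hr Hg Hpsi k Hk.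
assert (HD : forall a b, dirichlet_space (T (polynomial (two_term_coefs r a b) r))).
{ intros a' b'. apply HT, dirichlet_space_polynomial.
  intros j Hj. apply two_term_coefs_other; lia. }
assert (Dpsi : dirichlet_space psi).
{ replace psi with (T (polynomial (two_term_coefs r 1 0) r)); [apply HD|].
  apply functional_extensionality; intros z. unfold T, weighted_composition.
  rewrite polynomial_two_terms by exact Hr. ring. }
destruct (HD a b) as [_ [SF _]]. destruct Dpsi as [_ [Spsi _]].
set (F := T (polynomial (two_term_coefs r a b) r)) in *.
assert (E : taylor_coef F k - a * taylor_coef psi k = 0).
{ apply (cpseries_low_coefs_vanish r (fun n => taylor_coef F n - a * taylor_coef psi n)
    (fun z => b * g z * phi z ^ r)); [|now apply product_vanishes_at_origin|exact Hk].
  intros z _ Hz.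
  replace (z ^ r * (b * g z * phi z ^ r)) with (F z - a * psi z).
  - apply (is_pseries_minus (K := C_AbsRing) (V := C_NormedModule)); [now apply SF|].
    apply (is_pseries_scal (K := C_AbsRing) (V := C_NormedModule)); [|now apply Spsi].
    apply Cmult_comm.
  - unfold F, T, weighted_composition.
    rewrite polynomial_two_terms, (Hpsi z Hz) by exact Hr. ring. }
replace (taylor_coef F k) with (taylor_coef F k - a * taylor_coef psi k + a * taylor_coef psi k)
  by ring.
rewrite E. ring.
Qed.

(** For c <> 0 take a > 0 and let b be forced by the value w.  With
    q = |w| / ((r+1)|c|) the unit norm condition for X = a^2 becomes
    X^2 - X + (r+1) q^2 = 0.  Since q <= 1/(r+2), the discriminant is at least
    1 - 4(r+1)/(r+2)^2 = (r/(r+2))^2, which is nonnegative. *)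
Lemma two_dim_compression_range (r : nat) (c w : C) :
  (Cmod w <= (INR r + 1) / (INR r + 2) * Cmod c)%R ->
  exists a b : C, (Cmod a ^ 2 + (INR r + 1) * Cmod b ^ 2 = 1)%R /\
    w = RtoC (INR r + 1) * (a * c) * Cconj b.
Proof.
intros Hw. assert (R0 := pos_INR r). set (n := INR r) in *.
destruct (Ceq_dec c 0) as [C0|C0].
- exists 1, 0. rewrite C0, Cmod_0, Rmult_0_r in Hw. rewrite Cmod_1, Cmod_0.
  split; [ring|]. rewrite C0.
  assert (W0 : w = 0) by (apply Cmod_eq_0; generalize (Cmod_ge_0 w); lra).
  rewrite W0. ring.
- assert (Cp := proj1 (Cmod_gt_0 c) C0).
  set (q := (Cmod w / ((n + 1) * Cmod c))%R).
  assert (D0 : (0 < (n + 1) * Cmod c)%R) by (apply Rmult_lt_0_compat; lra).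
  assert (Q0 : (0 <= q)%R).
  { apply Rmult_le_pos; [apply Cmod_ge_0|]. left; now apply Rinv_0_lt_compat. }
  assert (Q1 : (q <= / (n + 2))%R).
  { unfold q. apply Rmult_le_reg_r with ((n + 1) * Cmod c)%R; [exact D0|].
    replace (Cmod w / ((n + 1) * Cmod c) * ((n + 1) * Cmod c))%R with (Cmod w)
      by (field; lra).
    eapply Rle_trans; [exact Hw|]. right; field; lra. }
  set (disc := (1 - 4 * (n + 1) * q ^ 2)%R).
  assert (DP : (0 <= disc)%R).
  { assert (q ^ 2 <= (/ (n + 2)) ^ 2)%R by (apply pow_incr; lra).
    assert (E : (1 - 4 * (n + 1) * (/ (n + 2)) ^ 2 = (n / (n + 2)) ^ 2)%R) by (field; lra).
    assert (0 <= (n / (n + 2)) ^ 2)%R by apply pow2_ge_0.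
    unfold disc. nra. }
  set (X := ((1 + sqrt disc) / 2)%R).
  assert (SD := sqrt_pos disc).
  assert (SS := sqrt_sqrt disc DP).
  assert (X0 : (0 < X)%R) by (unfold X; lra).
  assert (XE : (X * X - X + (n + 1) * q ^ 2 = 0)%R) by (unfold X, disc in *; nra).
  assert (SX : (0 < sqrt X)%R) by now apply sqrt_lt_R0.
  set (t := w / (RtoC ((n + 1) * sqrt X) * c)).
  assert (T0 : RtoC ((n + 1) * sqrt X) <> 0).
  { intros H; apply RtoC_inj in H. nra. }
  exists (RtoC (sqrt X)), (Cconj t). split.
  + rewrite Cmod_conj, Cmod_R, Rabs_pos_eq, pow2_sqrt by lra.
    unfold t. rewrite Cmod_div, Cmod_mult, Cmod_R, Rabs_pos_eq by (try apply Cmult_neq_0; try assumption; nra).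
    assert (E : (Cmod w / ((n + 1) * sqrt X * Cmod c) = q / sqrt X)%R)
      by (unfold q; field; lra).
    rewrite E. replace ((q / sqrt X) ^ 2)%R with (q ^ 2 / X)%R.
    * apply Rmult_eq_reg_r with X; [|lra].
      replace ((X + (n + 1) * (q ^ 2 / X)) * X)%R with (X * X + (n + 1) * q ^ 2)%R by (field; lra).
      lra.
    * unfold Rdiv at 2. rewrite Rpow_mult_distr, pow_inv, pow2_sqrt by lra. reflexivity.
  + rewrite Cconj_conj. unfold t. rewrite RtoC_mult in *. field.
    repeat split; try exact C0; intros H; apply T0; rewrite H; ring.
Qed.

Theorem theorem4p2 :
  forall (phi psi : C -> C) (r : nat),
    (forall z : C, Cmod z < 1 -> Cmod (phi z) < 1) ->
    holomorphic_on_disk phi ->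
    holomorphic_on_disk psi ->
    dirichlet_bounded (weighted_composition psi phi) ->
    phi (RtoC 0) = RtoC 0 ->
    (0 < r)%nat ->
    zero_of_multiplicity_at_origin psi r ->
    forall w : C,
      (Cmod w <= (INR r + 1) / (INR r + 2) * Cmod (taylor_coef psi r))%R ->
      numerical_range (weighted_composition psi phi) w.
Proof.
intros phi psi r Hdisk Hphi Hpsi [HT _] Hphi0 Hr [g [Hg [_ Hpsig]]] w Hw.
destruct (two_dim_compression_range r _ w Hw) as [a [b [Hab Hwab]]].
assert (P0 : taylor_coef psi 0 = 0).
{ change (psi 0 / 1 = 0). rewrite Hpsig by (rewrite Cmod_0; lra).
  destruct r as [|r]; [lia|]. rewrite Cpow_S. field. }
exists (polynomial (two_term_coefs r a b) r). split; [|split].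
- apply dirichlet_space_polynomial. intros k Hk. apply two_term_coefs_other; lia.
- rewrite dirichlet_norm_two_terms, Hab by exact Hr. apply sqrt_1.
- rewrite dirichlet_inner_two_terms by exact Hr.
  rewrite !(weighted_composition_taylor_coef phi psi g) by (auto; lia).
  rewrite P0, Hwab. ring.
Qed.
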